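(* Let $G,H$ be finite simple connected graphs, fix a root $(r_G,r_H)\in V(G\,\square\,H)$, let $K\in\{G,H\}$ with $\bar K$ the other graph, let $v\in V(\bar K)$ and $\eta\in\{1,2,\dots,\pi(\bar K)\}$. Let $S\subseteq V(\bar K)\setminus\{v\}$ satisfy \[ d:=\max_{w\in S} D_{\bar K}(v,w)\ \le\ \lceil \log_2 \pi(K)\rceil-1 \quad\text{and}\quad \eta\le |S|\le \pi(\bar K), \] and put $\chi=(2^d-1)+|S|-\eta$ and $M=2\pi(G)\pi(H)$. Then every configuration $c$ on $G\,\square\,H$ from which no sequence of pebbling moves places a pebble on $(r_G,r_H)$ satisfies \[ |K|(|S|-\eta)+extra_{K,v}+1\ \le\ \sum_{w\in S}2^{D_{\bar K}(v,w)}\bigl(\pi(K)-extra_{K,w}\bigr)+M\bigl(1-x_{K,v,\chi}\bigr)+M\bigl(1-y_{K,\pi(\bar K)-\eta}\bigr). \]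
   Context: The Cartesian product $G\,\square\,H$ has vertex set $V(G)\times V(H)$, with $(g,h)\sim(g',h')$ iff ($g=g'$ and $h\sim_H h'$) or ($h=h'$ and $g\sim_G g'$). $D_X$ denotes graph distance in $X$ and $|X|$ the number of vertices. A configuration is a function $c:V(G\,\square\,H)\to\mathbb{Z}_{\ge0}$. A pebbling move removes two pebbles from a vertex and adds one to an adjacent vertex. $\pi(X)$ (pebbling number) is the least $k$ such that from every configuration of size $k$ on $X$ and every root some sequence of pebbling moves places a pebble on the root. For $K\in\{G,H\}$, $\bar K$ is the other graph; for $j\in V(\bar K)$ the $K$-slice $K_j$ is $\{(i,j):i\in V(G)\}$ if $K=G$ and $\{(j,h):h\in V(H)\}$ if $K=H$. For a configuration $c$: $\tilde c_{K,j}=\sum_{u\in K_j}c(u)$; $set_{K,j}=\lfloor\tilde c_{K,j}/\pi(K)\rfloor$; $extra_{K,j}=\tilde c_{K,j}-\pi(K)\,set_{K,j}$; $sat_{K,j}=\lfloor(\tilde c_{K,j}-extra_{K,j})/|K|\rfloor$; $x_{K,j,t}=1$ if $sat_{K,j}\ge t$ and $0$ otherwise; $y_{K,s}=1$ if $\sum_{j\in V(\bar K)}set_{K,j}\ge s$ and $0$ otherwise. *)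

(* Defs.v *)
From mathcomp Require Import all_boot all_order all_algebra.
From mathcomp Require boolp classical_sets.
From Stdlib Require Relation_Operators.

Set Implicit Arguments.
Unset Strict Implicit.
Unset Printing Implicit Defensive.

Record sgraph := SGraph {
  vertex :> finType;
  adj : rel vertex;
  adj_sym : symmetric adj;
  adj_irrefl : irreflexive adj
}.

Definition connected (G : sgraph) : Prop := forall u v : G, connect (@adj G) u v.

(* The least length n < #|G| of a walk from u to v, and #|G| if there is none;
   see distP for the connected case. *)
Definition dist (G : sgraph) (u v : G) : nat :=
  find (fun n => [exists p : n.-tuple G, path (@adj G) u p && (last u p == v)])
       (iota 0 #|G|).

Section CartesianProduct.
Variables G H : sgraph.

Definition box_adj : rel (G * H) := fun x y =>
  ((x.1 == y.1) && adj x.2 y.2) || ((x.2 == y.2) && adj x.1 y.1).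

Lemma box_adj_sym : symmetric box_adj.
Proof.
by move=> x y; rewrite /box_adj (eq_sym y.1) (eq_sym y.2) (adj_sym y.1) (adj_sym y.2).
Qed.

Lemma box_adj_irrefl : irreflexive box_adj.
Proof. by move=> x; rewrite /box_adj !adj_irrefl !andbF. Qed.

Definition box : sgraph := SGraph box_adj_sym box_adj_irrefl.

End CartesianProduct.

Definition config (X : sgraph) := {ffun X -> nat}.

Definition config_size (X : sgraph) (c : config X) : nat := \sum_(u : X) c u.

Definition pebbling_move (X : sgraph) (c c' : config X) : Prop :=
  exists u v : X, [/\ adj u v, 2 <= c u &
    c' = [ffun x => if x == u then c x - 2
                    else if x == v then c x + 1 else c x]].

Definition pebbling_moves (X : sgraph) : config X -> config X -> Prop :=
  Relation_Operators.clos_refl_trans (config X) (@pebbling_move X).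

(* The empty sequence of moves is allowed. *)
Definition solvable (X : sgraph) (c : config X) (r : X) : Prop :=
  exists c' : config X, pebbling_moves c c' /\ 0 < c' r.

Definition pebbles_suffice (X : sgraph) (k : nat) : Prop :=
  forall (c : config X) (r : X), config_size c = k -> solvable c r.

Definition is_pebbling_number (X : sgraph) (k : nat) : Prop :=
  pebbles_suffice X k /\ forall m, pebbles_suffice X m -> k <= m.

(* The default 0 is never used on a connected graph: see pebbling_numberP. *)
Definition pebbling_number (X : sgraph) : nat :=
  classical_sets.xget 0 (is_pebbling_number X).

Variant side := SideG | SideH.

Definition other (K : side) : side :=
  match K with SideG => SideH | SideH => SideG end.

Definition factor (G H : sgraph) (K : side) : sgraph :=
  match K with SideG => G | SideH => H end.

Definition slice (G H : sgraph) (K : side) :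
    factor G H (other K) -> {set box G H} :=
  match K return factor G H (other K) -> {set box G H} with
  | SideG => fun j => [set ((i, j) : box G H) | i : G]
  | SideH => fun j => [set ((j, h) : box G H) | h : H]
  end.

Section SliceQuantities.
Variables (G H : sgraph) (K : side) (c : config (box G H)).
Implicit Type j : factor G H (other K).

Let pi_K := pebbling_number (factor G H K).

Definition slice_size j : nat := \sum_(u in slice j) c u.

Definition set_num j : nat := slice_size j %/ pi_K.

Definition extra j : nat := slice_size j - pi_K * set_num j.

Definition sat j : nat := (slice_size j - extra j) %/ #|factor G H K|.

Definition x_ind j (t : nat) : nat := if t <= sat j then 1 else 0.

Definition y_ind (s : nat) : nat :=
  if s <= \sum_(j : factor G H (other K)) set_num j then 1 else 0.

End SliceQuantities.

Arguments slice_size {G H} K c j.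
Arguments set_num {G H} K c j.
Arguments extra {G H} K c j.
Arguments sat {G H} K c j.
Arguments x_ind {G H} K c j t.
Arguments y_ind {G H} K c s.

Lemma distP (G : sgraph) (u v : G) : connected G ->
  (exists p, [/\ path (@adj G) u p, last u p = v & size p = dist u v]) /\
  (forall p, path (@adj G) u p -> last u p = v -> dist u v <= size p).
Proof.
move=> cG; rewrite /dist.
set a := fun n : nat => [exists p : n.-tuple G, path (@adj G) u p && (last u p == v)].
have aP p : path (@adj G) u p -> last u p = v -> a (size p).
  by move=> Pp Lp; apply/existsP; exists (in_tuple p); rewrite /= Pp Lp eqxx.
have min p : path (@adj G) u p -> last u p = v -> size p < #|G| ->
    find a (iota 0 #|G|) <= size p.
  move=> Pp Lp szp; rewrite leqNgt; apply/negP => lt.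
  by have := before_find 0 lt; rewrite nth_iota // add0n aP.
have [p0 Pp0 /esym Lp0] := connectP (cG u v).
have [p Pp [Lp szp]] : exists2 p, path (@adj G) u p & last u p = v /\ size p < #|G|.
  move: Lp0; case: (shortenP Pp0) => p Pp Up _ Lp; exists p => //; split=> //.
  by have := max_card (mem (u :: p)); rewrite (card_uniqP Up).
have ltd := leq_ltn_trans (min p Pp Lp szp) szp.
have hasa : has a (iota 0 #|G|) by rewrite has_find size_iota.
split.
  have := nth_find 0 hasa; rewrite nth_iota // add0n => /existsP[q /andP[Pq /eqP Lq]].
  by exists q; split=> //; rewrite size_tuple.
move=> q Pq Lq; case: (ltnP (size q) #|G|) => szq; first exact: min.
exact: leq_trans (ltnW ltd) szq.
Qed.

Lemma adj_moves (X : sgraph) (u v : X) (m : nat) (c : config X) :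
  adj u v -> 2 * m <= c u ->
  exists c', pebbling_moves c c' /\ m <= c' v.
Proof.
move=> uv; have neq : (v == u) = false.
  by apply/eqP => E; move: uv; rewrite E adj_irrefl.
have gen : forall m (c : config X), 2 * m <= c u ->
    exists c', pebbling_moves c c' /\ c v + m <= c' v.
  elim=> [|n IH] c' le.
    by exists c'; rewrite addn0; split=> //; apply: Relation_Operators.rt_refl.
  pose c1 : config X := [ffun x => if x == u then c' x - 2
                    else if x == v then c' x + 1 else c' x].
  have le2 : 2 <= c' u by apply: leq_trans le; rewrite mulnS leq_addr.
  have [|c2 [mv lev]] := IH c1.
    by rewrite ffunE eqxx leq_subRL // -mulnS.
  exists c2; split.
    apply: Relation_Operators.rt_trans mv; apply: Relation_Operators.rt_step.
    by exists u, v.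
  by move: lev; rewrite ffunE neq eqxx -addnA add1n.
move=> le; have [c' [mv lev]] := gen m c le.
by exists c'; split=> //; apply: leq_trans lev; rewrite leq_addl.
Qed.

Lemma path_solvable (X : sgraph) (p : seq X) (u : X) (c : config X) :
  path (@adj X) u p -> 2 ^ size p <= c u -> solvable c (last u p).
Proof.
elim: p u c => [|v p IH] u c /=.
  by move=> _ lt; exists c; split=> //; apply: Relation_Operators.rt_refl.
case/andP=> uv Pp; rewrite expnS => /(adj_moves uv)[c1 [mv lev]].
have [c2 [mv2 pos]] := IH v c1 Pp lev.
by exists c2; split=> //; apply: Relation_Operators.rt_trans mv mv2.
Qed.

Lemma pebbling_numberP (X : sgraph) :
  connected X -> is_pebbling_number X (pebbling_number X).
Proof.
move=> cX; apply: (@classical_sets.xgetPex _ 0 (is_pebbling_number X)).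
pose D := \max_(uv : X * X) dist uv.1 uv.2.
have ex : exists k, boolp.asbool (pebbles_suffice X k).
  exists (#|X| * 2 ^ D); apply/boolp.asboolP => c r szc.
  have [u leu] : exists u, 2 ^ D <= c u.
    apply/existsP; case: existsP => // nex; exfalso.
    have lt' u : c u < 2 ^ D by rewrite ltnNge; apply/negP => le; apply: nex; exists u.
    have : \sum_(u : X) (c u).+1 <= #|X| * 2 ^ D.
      by rewrite -sum_nat_const; apply: leq_sum => u _.
    rewrite -szc /config_size (eq_bigr (fun u => c u + 1)) => [|u _]; last by rewrite addn1.
    rewrite big_split /= sum1_card -[X in _ <= X]addn0 leq_add2l leqn0 => /eqP/card0_eq.
    by move/(_ r).
  have [[p [Pp <- szp]] _] := distP u r cX.
  apply: path_solvable => //; apply: leq_trans leu; rewrite leq_exp2l // szp.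
  exact: (leq_bigmax (F := fun uv : X * X => dist uv.1 uv.2) (u, last u p)).
case: (ex_minnP ex) => k /boolp.asboolP Pk kmin; exists k; split=> // m Pm.
by apply: kmin; apply/boolp.asboolP.
Qed.

(* Main.v *)
(** Write a slice of K as p-sets (p = pi(K)) plus a remainder.  If all slices
    together hold pi(Kbar) sets, the root is reachable: each set puts a pebble
    on the root's copy of Kbar, where pi(Kbar) pebbles suffice.  When both
    indicators are 1 and the inequality fails, ship pebbles from the slice of v
    to every slice w in S until its remainder is completed to a set.  This gains
    #|S| sets and, since #|K| <= p, costs the slice of v at most #|S| - eta of
    them, so pi(Kbar) sets result, a contradiction.  When an indicator is 0,
    the term M alone dominates the left-hand side. *)
Require Import Defs.
From mathcomp Require Import all_boot all_order all_algebra.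
From mathcomp Require Import zify.
From Stdlib Require Import Relation_Operators.
Import Order.TTheory GRing.Theory Num.Theory.

Set Implicit Arguments.
Unset Strict Implicit.
Unset Printing Implicit Defensive.

Local Open Scope nat_scope.

(** * Configurations under addition, and reachability up to surplus pebbles *)

Definition cadd (X : sgraph) (a b : config X) : config X := (a + b)%R.

Definition pile (X : sgraph) (u : X) (n : nat) : config X :=
  [ffun x => if x == u then n else 0].

Definition push (X Y : sgraph) (f : X -> Y) (c : config X) : config Y :=
  [ffun y => \sum_(x | f x == y) c x].

(** The surplus [e] is discarded, which makes the relation additive as well as transitive. *)
Definition reaches (X : sgraph) (c t : config X) : Prop :=
  exists e, pebbling_moves c (cadd t e).

Section Reaches.
Variable X : sgraph.
Implicit Types (a b c e : config X) (u v : X).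

Lemma caddE a b x : cadd a b x = a x + b x.
Proof. by rewrite /cadd ffunE. Qed.

Lemma caddC a b : cadd a b = cadd b a. Proof. exact: addrC. Qed.

Lemma caddA a b e : cadd a (cadd b e) = cadd (cadd a b) e.
Proof. exact: addrA. Qed.

Lemma cadd0 a : cadd a 0%R = a. Proof. exact: addr0. Qed.

Lemma caddACA a b e t : cadd (cadd a b) (cadd e t) = cadd (cadd a e) (cadd b t).
Proof. exact: addrACA. Qed.

Lemma config_le_split a c : (forall x, a x <= c x) -> exists b, c = cadd a b.
Proof.
move=> le; exists [ffun x => c x - a x]; apply/ffunP => x.
by rewrite caddE ffunE subnKC.
Qed.

Lemma pile_split u n c : n <= c u -> exists b, c = cadd (pile u n) b.
Proof.
by move=> le; apply: config_le_split => x; rewrite ffunE; case: eqP => // ->.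
Qed.

(** The bystanders [e] are separated from the two pebbles that move, so compatibility of moves with
    sums and with [push] becomes plain algebra. *)
Lemma pebbling_moveP c c' :
  pebbling_move c c' <-> exists u v e,
    [/\ adj u v, c = cadd (pile u 2) e & c' = cadd (pile v 1) e].
Proof.
have nadj u v : adj u v -> (u == v) = false.
  by move=> uv; apply/eqP => E; move: uv; rewrite E adj_irrefl.
split=> [[u [v [uv le ->]]]|[u [v [e [uv -> ->]]]]].
  have [e Ec] := pile_split le; exists u, v, e; split=> //; apply/ffunP => x.
  rewrite !(caddE, ffunE) Ec caddE ffunE.
  case: (eqVneq x u) => [->|_]; first by rewrite (nadj _ _ uv); lia.
  by case: eqP => _; lia.
exists u, v; split=> //; first by rewrite caddE ffunE eqxx; lia.
apply/ffunP => x; rewrite !(caddE, ffunE).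
case: (eqVneq x u) => [->|_]; first by rewrite (nadj _ _ uv); lia.
by case: eqP => _; lia.
Qed.

Lemma pebbling_moves_cadd c c' e :
  pebbling_moves c c' -> pebbling_moves (cadd c e) (cadd c' e).
Proof.
elim=> {c c'} [c c' /pebbling_moveP[u [v [b [uv -> ->]]]]|c|c1 c2 c3 _ IH1 _ IH2].
- by apply: rt_step; apply/pebbling_moveP; exists u, v, (cadd b e); rewrite !caddA.
- exact: rt_refl.
- exact: rt_trans IH1 IH2.
Qed.

Lemma reaches_refl c : reaches c c.
Proof. by exists 0%R; rewrite cadd0; apply: rt_refl. Qed.

Lemma reaches_trans b a c : reaches a b -> reaches b c -> reaches a c.
Proof.
move=> [e ab] [e' bc]; exists (cadd e' e); rewrite caddA.
exact: rt_trans ab (pebbling_moves_cadd e bc).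
Qed.

Lemma reaches_cadd a a' b b' :
  reaches a a' -> reaches b b' -> reaches (cadd a b) (cadd a' b').
Proof.
move=> [e aa] [e' bb]; exists (cadd e e'); rewrite -caddACA.
apply: rt_trans (pebbling_moves_cadd b aa) _.
by rewrite caddC (caddC _ (cadd b' e')); apply: pebbling_moves_cadd.
Qed.

Lemma reaches_sub c e : reaches (cadd c e) c.
Proof. by exists e; apply: rt_refl. Qed.

Lemma solvableP c r : solvable c r <-> reaches c (pile r 1).
Proof.
split=> [[c' [mv pos]]|[e mv]].
  by have [e Ec] := pile_split pos; exists e; rewrite -Ec.
by eexists; split; [exact: mv | rewrite caddE ffunE eqxx].
Qed.

Lemma config_size_cadd a b : config_size (cadd a b) = config_size a + config_size b.
Proof. by rewrite -big_split; apply: eq_bigr => x _; rewrite caddE. Qed.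

Lemma config_size_pile u n : config_size (pile u n) = n.
Proof.
rewrite /config_size (bigD1 u) //= ffunE eqxx big1 ?addn0 // => x /negPf ne.
by rewrite ffunE ne.
Qed.

(** [pebbles_suffice] concerns configurations of one exact size, so a larger one must first be
    cut. *)
Lemma config_size_split k c :
  k <= config_size c -> exists a b, c = cadd a b /\ config_size a = k.
Proof.
elim: k => [|k IH] le.
  exists 0%R, c; rewrite caddC cadd0; split=> //.
  by apply: big1 => x _; rewrite ffunE.
have [a [b [Ec Ea]]] := IH (ltnW le).
have [u bu] : exists u, 0 < b u.
  apply/existsP; apply: contraLR le => /existsPn b0.
  rewrite Ec config_size_cadd Ea -leqNgt /config_size big1 ?addn0 // => u _.
  by move: (b0 u); lia.
have [b' Eb] := pile_split bu; exists (cadd a (pile u 1)), b'.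
by rewrite Ec Eb caddA config_size_cadd Ea config_size_pile addn1.
Qed.

Lemma pileD u m n : pile u (m + n) = cadd (pile u m) (pile u n).
Proof. by apply/ffunP => x; rewrite caddE !ffunE; case: eqP. Qed.

Lemma reaches_pile_adj u v m : adj u v -> reaches (pile u (2 * m)) (pile v m).
Proof.
move=> uv; elim: m => [|m IH].
  rewrite muln0 (_ : pile v 0 = pile u 0); first exact: reaches_refl.
  by apply/ffunP => x; rewrite !ffunE !if_same.
rewrite mulnS pileD -[m.+1]add1n pileD; apply: reaches_cadd => //.
exists 0%R; apply: rt_step; apply/pebbling_moveP; exists u, v, 0%R.
by rewrite !cadd0.
Qed.

Lemma reaches_pile_dist u v m :
  connected X -> reaches (pile u (2 ^ dist u v * m)) (pile v m).
Proof.
move=> cX; have [[p [+ + <-]] _] := distP u v cX.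
elim: p u => [|w p IH] u /=; first by move=> _ ->; rewrite mul1n; apply: reaches_refl.
move=> /andP[uw pw] lp; rewrite expnS -mulnA.
exact: reaches_trans (reaches_pile_adj _ uw) (IH _ pw lp).
Qed.

(** Disjoint groups of exactly [pebbling_number X] pebbles work independently, each delivering one
    pebble to [r]. *)
Lemma reaches_pile_root c r m : connected X ->
  m * pebbling_number X <= config_size c -> reaches c (pile r m).
Proof.
move=> cX; have [suff _] := pebbling_numberP cX.
elim: m c => [|m IH] c le.
  have [e ->] := @pile_split r 0 c isT; exact: reaches_sub.
have [|a [b [Ec Ea]]] := @config_size_split (pebbling_number X) c.
  by apply: leq_trans le; rewrite mulSn leq_addr.
rewrite Ec -[m.+1]add1n pileD; apply: reaches_cadd.
  exact/solvableP/suff.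
apply: IH; move: le; rewrite Ec config_size_cadd Ea; lia.
Qed.

(** With at most one pebble on each vertex and none on the root, no move is possible. *)
Lemma card_le_pebbling_number : connected X -> #|X| <= pebbling_number X.
Proof.
move=> cX; have [suff _] := pebbling_numberP cX.
rewrite leqNgt; apply/negP => lt.
have /card_gt0P[r _] : 0 < #|X| by apply: leq_ltn_trans lt.
pose c0 : config X := [ffun x => nat_of_bool (x != r)].
have sz0 : config_size c0 = #|X|.-1.
  rewrite -(cardC1 r) -sum1_card [RHS]big_mkcond.
  by apply: eq_bigr => x _; rewrite ffunE.
(* If the bound failed, [c0], of size [#|X| - 1], could be cut down to exactly [pebbling_number X]
   pebbles; the piece [a] is as stuck as [c0]. *)
have [|a [b [Ec Ea]]] := @config_size_split (pebbling_number X) c0.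
  by rewrite sz0; lia.
have le x : a x <= (x != r).
  by have /ffunP/(_ x) := Ec; rewrite caddE ffunE => ->; rewrite leq_addr.
have stuck c1 c' : pebbling_moves c1 c' -> c1 = a -> c' = a.
  elim=> {c1 c'} // [c1 c' [u [w [_ ge2 _]]] E|c1 c2 c3 _ IH1 _ IH2 /IH1 //].
  by move: ge2 (le u); rewrite E; case: (u != r) => /=; lia.
have [c' [mv pos]] := suff a r Ea.
by move: pos (le r); rewrite (stuck _ _ mv erefl) eqxx; lia.
Qed.

End Reaches.

(** * Transport of moves along adjacency-preserving maps *)

Section Push.
Variables (X Y : sgraph) (f : X -> Y).
Hypothesis f_adj : forall u v, adj u v -> adj (f u) (f v).

Lemma push_cadd a b : push f (cadd a b) = cadd (push f a) (push f b).
Proof.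
apply/ffunP => y; rewrite caddE !ffunE -big_split.
by apply: eq_bigr => x _; rewrite caddE.
Qed.

Lemma push_pile u n : push f (pile u n) = pile (f u) n.
Proof.
apply/ffunP => y; rewrite !ffunE big_mkcond (bigD1 u) //= ffunE eqxx eq_sym.
rewrite big1 ?addn0 // => x /negPf ne.
by rewrite ffunE ne if_same.
Qed.

Lemma reaches_push c c' : reaches c c' -> reaches (push f c) (push f c').
Proof.
move=> [e mv]; exists (push f e); rewrite -push_cadd.
elim: mv => {c c' e} [c c' /pebbling_moveP[u [v [b [uv -> ->]]]]|c|c1 c2 c3 _ IH1 _ IH2].
- apply: rt_step; apply/pebbling_moveP; exists (f u), (f v), (push f b).
  by rewrite !push_cadd !push_pile; split=> //; apply: f_adj.
- exact: rt_refl.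
- exact: rt_trans IH1 IH2.
Qed.

Lemma solvable_push c r : solvable c r -> solvable (push f c) (f r).
Proof. by move=> /solvableP/reaches_push; rewrite push_pile => /solvableP. Qed.

End Push.

(** * Layers of a product and shipping between them *)

Section Product.
Variables A B : sgraph.
Hypotheses (cA : connected A) (cB : connected B).

Definition layer (c : config (box A B)) (j : B) : config A := [ffun a => c (a, j)].

Definition layer_size (c : config (box A B)) (j : B) : nat := \sum_(a : A) c (a, j).

Lemma pair_adj_l (j : B) (a a' : A) :
  adj a a' -> adj ((a, j) : box A B) ((a', j) : box A B).
Proof. by move=> aa; rewrite /adj /= /box_adj /= eqxx aa orbT. Qed.

Lemma pair_adj_r (a : A) (b b' : B) :
  adj b b' -> adj ((a, b) : box A B) ((a, b') : box A B).
Proof. by move=> bb; rewrite /adj /= /box_adj /= eqxx bb. Qed.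

Lemma layer_size_cadd c c' j :
  layer_size (cadd c c') j = layer_size c j + layer_size c' j.
Proof. by rewrite -big_split; apply: eq_bigr => a _; rewrite caddE. Qed.

Lemma layer_size_pile (a : A) (b j : B) n :
  layer_size (pile ((a, b) : box A B) n) j = (j == b) * n.
Proof.
rewrite /layer_size (bigD1 a) //= ffunE big1 => [|a' /negPf ne].
  by rewrite addn0 xpair_eqE eqxx /=; case: eqP => _; rewrite ?mul1n.
by rewrite ffunE xpair_eqE ne.
Qed.

Lemma sum_push_layers (c : config (box A B)) :
  (\sum_j (push (fun a => (a, j) : box A B) (layer c j) : {ffun A * B -> nat}))%R = c.
Proof.
apply/ffunP => [[a b]]; rewrite sum_ffunE (bigD1 b) //= ffunE.
rewrite (big_pred1 a) => [|x]; last by rewrite xpair_eqE eqxx andbT.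
rewrite ffunE big1 ?addr0 // => j /negPf ne; rewrite ffunE big_pred0 // => x.
by rewrite xpair_eqE ne andbF.
Qed.

Lemma sum_pile_push (m : B -> nat) (a : A) :
  (\sum_j (pile ((a, j) : box A B) (m j) : {ffun A * B -> nat}))%R =
  push (fun b => (a, b) : box A B) [ffun j => m j].
Proof.
apply/ffunP => y; rewrite sum_ffunE ffunE [RHS]big_mkcond /=.
by apply: eq_bigr => j _; rewrite !ffunE eq_sym.
Qed.

(* Concentrate each layer on its copy of the A-root, then pebble inside the
   copy of B through that root. *)
Lemma solvable_of_layers (c : config (box A B)) (rA : A) (rB : B) :
  pebbling_number B <= \sum_j layer_size c j %/ pebbling_number A ->
  solvable c ((rA, rB) : box A B).
Proof.
move=> le; apply/solvableP; set m := fun j => layer_size c j %/ pebbling_number A.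
apply: (@reaches_trans _ (push (fun b => (rA, b) : box A B) [ffun j => m j])).
  rewrite -{1}(sum_push_layers c) -sum_pile_push.
  (* Reachability is compatible with sums, so each layer can be treated alone. *)
  apply: (big_ind2 (@reaches (box A B))) => [|a a' b b'|j _].
  - exact: reaches_refl.
  - exact: reaches_cadd.
  - rewrite -(push_pile (fun a : A => (a, j) : box A B)).
    apply: reaches_push; first exact: pair_adj_l.
    apply: reaches_pile_root => //; rewrite (_ : config_size _ = layer_size c j).
      exact: leq_divM.
    by apply: eq_bigr => a _; rewrite ffunE.
rewrite -(push_pile (fun b => (rA, b) : box A B)).
apply: reaches_push; first exact: pair_adj_r.
apply: reaches_pile_root => //; rewrite mul1n; apply: leq_trans le _.
by apply: leq_sum => j _; rewrite ffunE.
Qed.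

Lemma layer_pile (c : config (box A B)) v d :
  #|A| * (2 ^ d - 1) < layer_size c v -> exists a : A, 2 ^ d <= c (a, v).
Proof.
move=> lt; apply/existsP; apply: contraLR lt => /existsPn small.
rewrite -leqNgt -sum_nat_const; apply: leq_sum => a _.
by move: (small a); lia.
Qed.

(** A pile found by pigeonhole in layer [v] travels along a copy of B, halving at each step. The
    balance keeps the cost on the left to avoid truncated subtraction. *)
Lemma ship_one (c : config (box A B)) v w d : dist v w <= d ->
  #|A| * (2 ^ d - 1) < layer_size c v ->
  exists2 c', reaches c c' &
    forall j, layer_size c' j + (j == v) * 2 ^ dist v w = layer_size c j + (j == w).
Proof.
move=> ld /layer_pile[a le].
have [e Ec] : exists e, c = cadd (pile ((a, v) : box A B) (2 ^ dist v w)) e.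
  by apply: pile_split; apply: leq_trans le; rewrite leq_exp2l.
exists (cadd (pile ((a, w) : box A B) 1) e) => [|j].
  rewrite Ec; apply: reaches_cadd; last exact: reaches_refl.
  rewrite -!(push_pile (fun b => (a, b) : box A B)).
  apply: reaches_push; first exact: pair_adj_r.
  by rewrite -[2 ^ _]muln1; apply: reaches_pile_dist.
by rewrite Ec !layer_size_cadd !layer_size_pile; lia.
Qed.

(* The reserve of #|A| * (2 ^ d - 1) pebbles guarantees by pigeonhole that
   some vertex of the layer v always holds the 2 ^ d pebbles of a shipment. *)
Lemma ship_all (c : config (box A B)) v d (m : B -> nat) :
  (forall w, 0 < m w -> dist v w <= d) ->
  #|A| * (2 ^ d - 1) + \sum_w 2 ^ dist v w * m w <= layer_size c v ->
  exists2 c', reaches c c' &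
    forall j, layer_size c' j + (j == v) * \sum_w 2 ^ dist v w * m w
              = layer_size c j + m j.
Proof.
move En: (\sum_w m w) => n; elim: n m c En => [|n IH] m c En md le.
  have m0 j : m j = 0.
    by apply/eqP; rewrite -leqn0 -En (bigD1 j) //= leq_addr.
  exists c => [|j]; first exact: reaches_refl.
  by rewrite m0 big1 ?muln0 // => w _; rewrite m0 muln0.
have [w mw] : exists w, 0 < m w.
  apply/existsP; apply: contra_eqT En => /existsPn m0.
  by rewrite big1 // => w _; move: (m0 w); lia.
(* The order that remains after one pebble has been delivered to [w]. *)
pose m' w' := m w' - (w' == w).
have Em j : m j = m' j + (j == w) by rewrite /m'; case: eqP => [->|_]; lia.
have sum1 (F : B -> nat) : \sum_j F j * (j == w) = F w.
  rewrite (bigD1 w) //= eqxx muln1 big1 ?addn0 // => j /negPf ->.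
  by rewrite muln0.
have Es : \sum_j 2 ^ dist v j * m j = \sum_j 2 ^ dist v j * m' j + 2 ^ dist v w.
  rewrite -(sum1 (fun j => 2 ^ dist v j)) -big_split; apply: eq_bigr => j _.
  by rewrite Em mulnDr.
have pos : 0 < 2 ^ dist v w by rewrite expn_gt0.
rewrite Es in le *.
(* A pending shipment costs at least one pebble, so the reserve bound is strict, as [ship_one]
   requires. *)
have [|c1 cc1 L1] := @ship_one c v w d (md w mw); first by lia.
have [|||c2 cc2 L2] := IH m' c1.
- apply: (@addIn 1); rewrite [RHS]addn1 -En -{1}(sum1 (fun=> 1)) -big_split.
  by apply: eq_bigr => j _; rewrite mul1n /= -Em.
- by move=> w' pos'; apply: md; rewrite Em; lia.
- by move: (L1 v); rewrite eqxx; lia.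
exists c2 => [|j]; first exact: reaches_trans cc1 cc2.
by move: (L1 j) (L2 j); rewrite Em; lia.
Qed.

(** The case of both indicators equal to 1, in natural numbers and by contraposition. *)
Lemma unsolvable_layers (c : config (box A B)) (rA : A) (rB v : B)
    (S : {set B}) (eta : nat) :
  let p := pebbling_number A in
  let q := pebbling_number B in
  let sets j := layer_size c j %/ p in
  let rest j := layer_size c j %% p in
  let d := \max_(w in S) dist v w in
  v \notin S -> eta <= #|S| -> eta <= q ->
  #|A| * (2 ^ d - 1 + (#|S| - eta)) <= p * sets v ->
  q - eta <= \sum_j sets j ->
  ~ solvable c ((rA, rB) : box A B) ->
  #|A| * (#|S| - eta) + rest v < \sum_(w in S) 2 ^ dist v w * (p - rest w).
Proof.
move=> p q sets rest d vS leS etaq satv sety; apply: contra_notT.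
rewrite -leqNgt => le.
have Ap : #|A| <= p by apply: card_le_pebbling_number.
have p0 : 0 < p by apply: leq_trans Ap; apply/card_gt0P; exists rA.
(* The number of pebbles that completes the remainder of layer [w] to a full set. *)
pose m w := (w \in S) * (p - rest w).
have Esum : \sum_w 2 ^ dist v w * m w = \sum_(w in S) 2 ^ dist v w * (p - rest w).
  rewrite [RHS]big_mkcond; apply: eq_bigr => w _; rewrite /m.
  by case: (w \in S); rewrite ?mul1n // mul0n muln0.
have Ev j : layer_size c j = p * sets j + rest j by rewrite mulnC; apply: divn_eq.
have [| |c' cc' L] := @ship_all c v d m.
- move=> w; rewrite /m; case: (boolP (w \in S)) => // wS _.
  exact: (leq_bigmax_cond (F := fun w => dist v w)).
(* The negated conclusion [le] bounds the cost by [#|A| * (#|S| - eta) + rest v], and [satv] covers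
   this together with the reserve. *)
- by rewrite Esum Ev; move: le satv; lia.
apply/solvableP; apply: reaches_trans cc' _; apply/solvableP.
apply: solvable_of_layers; rewrite -/p -/q.
(* Each layer in [S] gains a set. Layer [v] pays from [rest v] and at most [#|A| * (#|S| - eta)]
   further pebbles, so [#|A| <= p] limits its loss to [#|S| - eta] sets. *)
have key j : sets j + (j \in S) <= layer_size c' j %/ p + (j == v) * (#|S| - eta).
  rewrite [leqRHS]addnC -leq_subLR leq_divRL //; move: (L j); rewrite Esum /m.
  case: (eqVneq j v) => [->|_].
    by rewrite (negPf vS) Ev; move: le; nia.
  have := ltn_pmod (layer_size c j) p0; rewrite -/(rest j) Ev.
  by case: (j \in S); nia.
(* Summed over [j], the gain [#|S|] less the loss [#|S| - eta] is [eta], which raises [q - eta] sets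
   to [q]. *)
have : \sum_j (sets j + (j \in S))
    <= \sum_j (layer_size c' j %/ p + (j == v) * (#|S| - eta)).
  by apply: leq_sum => j _; apply: key.
rewrite !big_split /= -[\sum_i (i \in S)]big_mkcond sum1_card.
rewrite -big_distrl /= -[\sum_i (i == v)]big_mkcond sum1_card card1.
by move: sety leS etaq; lia.
Qed.

End Product.

(** * Slices of either factor as layers *)

Section Sides.
Variables (G H : sgraph) (K : side).

(** For [SideH] the coordinate swap is a graph map between the two products, so a solution of the
    swapped configuration is carried back by [push]. *)
Lemma slice_layers (c : config (box G H)) (r : box G H) :
  exists (c' : config (box (factor G H K) (factor G H (other K)))) rA rB,
    (forall j, layer_size c' j = slice_size K c j) /\
    (solvable c' ((rA, rB) : box _ _) -> solvable c r).
Proof.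
case: K; case: r => rG rH /=.
  exists c, rG, rH; split=> // j; rewrite /slice_size /= big_imset //=.
  by move=> a a' _ _ [].
pose f (x : box H G) : box G H := (x.2, x.1).
pose c' : config (box H G) := [ffun x => c (f x)].
exists c', rH, rG; split=> [j|].
  rewrite /slice_size /= big_imset /=; last by move=> a a' _ _ [].
  by apply: eq_bigr => a _; rewrite ffunE.
have -> : c = push f c'.
  apply/ffunP => [[g h]]; rewrite ffunE (big_pred1 ((h, g) : box H G)) ?ffunE //.
  by move=> [h' g']; rewrite /f /= !xpair_eqE andbC.
move/solvable_push; apply => u v.
by rewrite /f /adj /= /box_adj /= orbC.
Qed.

End Sides.

(** * The integer inequality and its indicators *)

Local Open Scope ring_scope.

Theorem theorem2 (G H : sgraph) (hG : connected G) (hH : connected H)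
    (rG : G) (rH : H) (K : side)
    (v : factor G H (other K)) (eta : nat)
    (heta : (1 <= eta <= pebbling_number (factor G H (other K)))%N)
    (S : {set factor G H (other K)}) (hvS : v \notin S) :
  let piK := pebbling_number (factor G H K) in
  let piKbar := pebbling_number (factor G H (other K)) in
  let d := (\max_(w in S) dist v w)%N in
  let chi := ((2 ^ d - 1) + (#|S| - eta))%N in
  let M := (2 * pebbling_number G * pebbling_number H)%N in
  d%:Z <= (up_log 2 piK)%:Z - 1 ->
  (eta <= #|S| <= piKbar)%N ->
  forall c : config (box G H),
    ~ solvable c ((rG, rH) : box G H) ->
    #|factor G H K|%:Z * (#|S|%:Z - eta%:Z) + (extra K c v)%:Z + 1
    <= (\sum_(w in S) 2 ^+ dist v w * (piK%:Z - (extra K c w)%:Z))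
       + M%:Z * (1 - (x_ind K c v chi)%:Z)
       + M%:Z * (1 - (y_ind K c (piKbar - eta)%N)%:Z).
Proof.
move=> piK piKbar d chi M _ /andP[leS Sq] c unsolv.
have conn L : connected (factor G H L) by case: L.
have [c' [rA [rB [Lc sol]]]] := slice_layers K c (rG, rH).
have unsolv' : ~ solvable c' ((rA, rB) : box _ _) by move/sol.
have nK := card_le_pebbling_number (conn K); rewrite -/piK in nK.
have n0 : (0 < #|factor G H K|)%N by apply/card_gt0P; exists rA.
have EM : M = (2 * piK * piKbar)%N.
  by rewrite /M /piK /piKbar; case: (K) => //=; rewrite mulnAC.
have Ex j : extra K c j = (layer_size c' j %% piK)%N.
  by rewrite /extra /set_num -Lc -/piK {1}(divn_eq (layer_size c' j) piK) mulnC addKn.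
have Eset j : set_num K c j = (layer_size c' j %/ piK)%N by rewrite /set_num Lc.
have exlt j : (extra K c j < piK)%N.
  by rewrite Ex ltn_pmod // (leq_trans n0 nK).
have -> : \sum_(w in S) 2 ^+ dist v w * (piK%:Z - (extra K c w)%:Z) =
    (\sum_(w in S) 2 ^ dist v w * (piK - extra K c w))%N%:Z.
  rewrite -[RHS]natz natr_sum; apply: eq_bigr => w _.
  by rewrite (subzn (ltnW (exlt w))) -[(piK - _)%N%:Z]natz natrM natrX.
rewrite subzn // -PoszM /x_ind /y_ind.
(* Since [eta >= 1], [#|S| - eta] is at most [piKbar - 1]; with [#|K| <= piK] and [extra < piK] the
   left side is at most [piK * piKbar]. *)
have triv : (#|factor G H K| * (#|S| - eta) + extra K c v + 1 <= M)%N.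
  rewrite EM; move: (exlt v) Sq heta nK; nia.
have [satv|_] := leqP chi (sat K c v); last first.
  by case: ifP => _; move: triv; lia.
have [sety|_] := leqP (piKbar - eta)%N (\sum_j set_num K c j)%N; last first.
  by move: triv; lia.
(* The numerator of [sat] is [piK] times the number of sets, so [chi <= sat] can be cleared of its
   division by [#|K|]. *)
have satv' : (#|factor G H K| * chi <= piK * (layer_size c' v %/ piK))%N.
  rewrite mulnC -leq_divRL //; apply: leq_trans satv _; apply: leq_div2r.
  by rewrite Ex -Lc {1}(divn_eq (layer_size c' v) piK) addnK mulnC.
have sety' : (piKbar - eta <= \sum_j layer_size c' j %/ piK)%N.
  by apply: leq_trans sety _; rewrite leq_eqVlt (eq_bigr _ (fun j _ => Eset j)) eqxx.
have /andP[_ etaq] := heta.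
have := unsolvable_layers (conn K) (conn (other K)) hvS leS etaq satv' sety' unsolv'.
rewrite -Ex (eq_bigr (fun w => 2 ^ dist v w * (piK - extra K c w)))%N => [|w _].
  lia.
by rewrite Ex.
Qed.
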